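(* Let $t \ge n > 0$ be integers and let $r_1,\dots,r_n \ge 0$ and $w_1,\dots,w_n \ge 0$ be arbitrary. Then for every $\theta \in \mathbb{R}$, $$\mathsf{M}_t\big(\mathbb{D}_n(r_1,\dots,r_n)\,\big|\,\mathbb{D}_n(w_1,\dots,w_n)\big) = M_t\Big(\prod_{k=1}^n (z - r_k e^{i\theta})\,\Big|\,\mathbb{D}_n(w_1,\dots,w_n)\Big) = \sum_{k=1}^n w_k\, s_{(t-n|n-k)}(r_1,\dots,r_n).$$ Moreover, the supremum defining $M_t\big(\prod_{k=1}^n (z - r_k e^{i\theta})\,|\,\mathbb{D}_n(w_1,\dots,w_n)\big)$ is attained at the solution with initial values $x_{k-1} = -w_k e^{i(\pi-\theta)(n-k+1)}$, $k = 1,\dots,n$.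
   Context: For a monic polynomial $f(z) = \sum_{k=0}^n f_k z^k$ ($f_n = 1$) of degree $n$, consider the homogeneous linear difference equation $\sum_{k=0}^n f_k x_{s+k} = 0$ for all integers $s \ge 0$, with unknown complex sequence $x = (x_0,x_1,\dots)$; its solution set is $X(f)$. For a set $U \subseteq \mathbb{C}^n$ of initial values, define $$M_t(f|U) := \sup\{|x_t| : x \in X(f),\ (x_0,\dots,x_{n-1}) \in U\}.$$ For $Z \subseteq \mathbb{C}^n$, define $\mathsf{M}_t(Z|U) := \sup M_t(f|U)$, the supremum being over all monic polynomials $f(z) = \prod_{j=1}^n (z - z_j)$ with $(z_1,\dots,z_n) \in Z$. $\mathbb{D}(r) = \{z \in \mathbb{C} : |z| \le r\}$ is the closed disc, and $\mathbb{D}_n(r_1,\dots,r_n) = \mathbb{D}(r_1)\times\dots\times\mathbb{D}(r_n)$; the radii may vanish and may exceed $1$. For integers $a,b \ge 0$, $(a|b)$ denotes the hook partition $(a+1,1,\dots,1)$ with $b$ trailing ones, and $s_{(a|b)}(x_1,\dots,x_n)$ is the corresponding Schur polynomial: the sum, over all semistandard Young tableaux of shape $(a|b)$ (rows weakly increasing, columns strictly increasing) with entries in $\{1,\dots,n\}$, of the product of $x_i$ over the entries $i$ of the tableau. *)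

(* Defs.v *)
From HB Require Import structures.
From mathcomp Require Import all_boot all_order all_algebra.
From mathcomp Require Import complex.
From mathcomp Require Import all_classical all_reals all_analysis.

Set Implicit Arguments.
Unset Strict Implicit.
Unset Printing Implicit Defensive.

Import Order.TTheory GRing.Theory Num.Theory.
Import ComplexField.Normc.

Local Open Scope classical_set_scope.
Local Open Scope ring_scope.
Local Open Scope complex_scope.

(* Points of C^n and of R^n are row vectors; the coordinate with 1-based index
   k is [v 0 j] with [j : 'I_n] and [k = j.+1]. *)

Section DifferenceEquations.
Variable R : realType.
Implicit Types (f : {poly R[i]}) (x : nat -> R[i]).

Definition cis (a : R) : R[i] := cos a +i* sin a.

Definition solutions f : set (nat -> R[i]) :=
  [set x | forall s : nat, \sum_(k < size f) f`_k * x (s + k)%N = 0].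

Definition initial (n : nat) x : 'rV[R[i]]_n := \row_(k < n) x k.

Definition root_poly (n : nat) (z : 'rV[R[i]]_n) : {poly R[i]} :=
  \prod_(j < n) ('X - (z 0 j)%:P).

(* Suprema are taken in [\bar R], so that they exist unconditionally and an
   equality with a finite value asserts boundedness.  [M] is meant for
   [f] monic of degree [n]. *)
Definition M (n t : nat) f (U : set 'rV[R[i]]_n) : \bar R :=
  ereal_sup [set (normc (x t))%:E | x in solutions f `&` initial n @^-1` U].

Definition MM (n t : nat) (Z U : set 'rV[R[i]]_n) : \bar R :=
  ereal_sup [set M t (root_poly z) U | z in Z].

Definition polydisc (n : nat) (r : 'rV[R]_n) : set 'rV[R[i]]_n :=
  [set z | forall j : 'I_n, normc (z 0 j) <= r 0 j].

End DifferenceEquations.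

Section Schur.

(* A cell of the Young diagram of [la] is a dependent pair: [tag c] is its row
   and [tagged c] its column, both counted from 0. *)
Definition cell (la : seq nat) : finType :=
  {i : 'I_(size la) & 'I_(nth 0%N la i)}.

(* Entries are in {0, ..., n - 1} instead of {1, ..., n}. *)
Definition semistandard (n : nat) (la : seq nat)
    (T : {ffun cell la -> 'I_n}) : bool :=
  [forall c : cell la, forall d : cell la,
    (((tag c == tag d) && (tagged c < tagged d)) ==> (T c <= T d)) &&
    (((tagged c == tagged d :> nat) && (tag c < tag d)) ==> (T c < T d))]%N.

Definition schur (R : comNzRingType) (n : nat) (la : seq nat)
    (x : 'rV[R]_n) : R :=
  \sum_(T : {ffun cell la -> 'I_n} | semistandard T) \prod_(c : cell la) x 0 (T c).

Definition hook (a b : nat) : seq nat := a.+1 :: nseq b 1%N.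

End Schur.

(* Main.v *)
Require Import Defs.
From HB Require Import structures.
From mathcomp Require Import all_boot all_order all_algebra.
From mathcomp Require Import complex.
From mathcomp Require Import all_classical all_reals all_analysis.
From mathcomp Require Import ring.
From mathcomp Require mpoly.

Set Implicit Arguments.
Unset Strict Implicit.
Unset Printing Implicit Defensive.

Import Order.TTheory GRing.Theory Num.Theory.
Import ComplexField.Normc.

Local Open Scope classical_set_scope.
Local Open Scope ring_scope.
Local Open Scope complex_scope.

(** The value [x t] of a solution is a linear form in the initial values whose
    coefficients are, up to sign, hook Schur polynomials of the roots:
      [x (n + a) = \sum_(j < n) (-1) ^+ (n - j.+1) * s_(a|n - j.+1)(z) * x j]
    ([solution_term]). This is proved by induction on [a]. A shifted solution
    is again a solution, so [x (n + a.+1)] is the same form in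
    [x 1, .., x n]; eliminating [x n] by the equation, whose coefficients are
    elementary symmetric polynomials by Vieta, leaves exactly the Pieri rule
      [h_(a+1) e_(b+1) = s_(a|b+1) + s_(a+1|b)]   ([hook_pieri]).

    The Pieri rule is a bijection once a hook tableau is read as a pair of
    words, its row [u] (weakly increasing) and the rest [v] of its first column
    (strictly increasing), with the corner [head u] smaller than
    [head v] ([schur_hookE]). Given a weak word [u] and a strict word [v], either
    [head u < head v] and they form a hook tableau already, or
    [head v <= head u] and moving [head v] to the front of the row gives one.

    Schur polynomials have nonnegative coefficients, so the triangle inequality
    gives [|x t| <= \sum_j w_j s_(t-n|n-j-1)(r)] over the whole polydisc
    ([solution_bound]). For roots [r_j e^(i theta)] on one ray, homogeneity
    pulls the phase [e^(i theta (t - j))] out of the [j]-th Schur polynomial,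
    and the prescribed phases of the initial values cancel both these phases
    and the alternating signs, up to the common factor [e^(i theta (t - n))].
    All terms are then aligned and the bound is attained
    ([aligned_solution_term]). *)

(** * Hook tableaux as pairs of words *)

(** The diagram is a dependent pair type, so equal cells may have
    syntactically different column types; comparing both coordinates in [nat]
    avoids casts. *)
Lemma cell_eq (la : seq nat) (c d : cell la) :
  tag c = tag d :> nat -> tagged c = tagged d :> nat -> c = d.
Proof.
case: c d => [i j] [i' j'] /= /val_inj eq_i; case: i' / eq_i j' => j'.
by move=> /val_inj ->.
Qed.

Section HookTableaux.
Variable n : nat.

Definition weak (s : seq 'I_n) : bool := sorted leq [seq val i | i <- s].
Definition strict (s : seq 'I_n) : bool := sorted ltn [seq val i | i <- s].

Lemma weak_nth (s : seq 'I_n) (i0 : 'I_n) i j : weak s ->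
  (i <= j)%N -> (j < size s)%N -> (nth i0 s i <= nth i0 s j)%N.
Proof.
move=> ws lij ltj; have lti := leq_ltn_trans lij ltj.
have := sorted_leq_nth leq_trans leqnn (val i0) ws.
move=> /(_ i j); rewrite !inE !size_map => /(_ lti ltj lij).
by rewrite !(nth_map i0).
Qed.

Lemma strict_nth (s : seq 'I_n) (i0 : 'I_n) i j : strict s ->
  (i < j)%N -> (j < size s)%N -> (nth i0 s i < nth i0 s j)%N.
Proof.
move=> ws lij ltj; have lti := ltn_trans lij ltj.
have := sorted_ltn_nth ltn_trans (val i0) ws.
move=> /(_ i j); rewrite !inE !size_map => /(_ lti ltj lij).
by rewrite !(nth_map i0).
Qed.

Section Shape.
Variables a b : nat.
Local Notation hcell := (cell (hook a b)).
Local Notation words := (a.+1.-tuple 'I_n * b.-tuple 'I_n)%type.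

(** The corner of the hook belongs to the row word; putting it in front of the
    column word states the strict increase down the whole first column. *)
Definition hook_words (p : words) : bool :=
  weak p.1 && strict (thead p.1 :: p.2).

Lemma tagged_row_lt (c : hcell) : val (tag c) = 0%N -> (tagged c < a.+1)%N.
Proof. by case: c => [[[|i] lti] j]. Qed.

Lemma tag_hook_lt (c : hcell) : (tag c < b.+1)%N.
Proof. by apply: (leq_trans (ltn_ord (tag c))); rewrite /= size_nseq. Qed.

Lemma tagged_col0 (c : hcell) : val (tag c) <> 0%N -> val (tagged c) = 0%N.
Proof.
case: c => [[[|i] lti] [j ltj]] //= _; move: (ltj).
have lti' : (i < b)%N by move: (lti); rewrite /= size_nseq.
by rewrite /= nth_nseq lti'; case: (j).
Qed.

Definition row_cell (k : 'I_a.+1) : hcell :=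
  @Tagged 'I_(size (hook a b)) ord0 (fun i => 'I_(nth 0%N (hook a b) i)) k.

Fact col_row_proof (k : 'I_b) : (k.+1 < size (hook a b))%N.
Proof. by rewrite /= size_nseq ltnS. Qed.

Fact col_col_proof (k : 'I_b) :
  (0 < nth 0%N (hook a b) (Ordinal (col_row_proof k)))%N.
Proof. by rewrite /= nth_nseq ltn_ord. Qed.

Definition col_cell (k : 'I_b) : hcell :=
  @Tagged 'I_(size (hook a b)) (Ordinal (col_row_proof k))
    (fun i => 'I_(nth 0%N (hook a b) i)) (Ordinal (col_col_proof k)).

Lemma first_column_cell k : (k < b.+1)%N ->
  exists2 c : hcell, val (tag c) = k & val (tagged c) = 0%N.
Proof.
case: k => [_|k ltk]; first by exists (row_cell ord0).
by exists (col_cell (Ordinal (ltk : (k < b)%N))).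
Qed.

(** A hook is the disjoint union of its row and of its column below the corner;
    numbering the cells along the former, then down the latter, gives the
    reindexing. *)
Lemma prod_hook_cells (R : comNzRingType) (F : hcell -> R) :
  \prod_c F c =
  (\prod_(k < a.+1) F (row_cell k)) * \prod_(k < b) F (col_cell k).
Proof.
pose h (k : 'I_(a.+1 + b)) : hcell :=
  match fintype.split k with inl i => row_cell i | inr j => col_cell j end.
pose g (c : hcell) : 'I_(a.+1 + b) :=
  inord (if val (tag c) is i.+1 then a.+1 + i else tagged c).
have gv (c : hcell) :
    (val (g c) = if val (tag c) is i.+1 then a.+1 + i else tagged c)%N.
  rewrite /= inordK //;
    case: c (@tagged_row_lt c) (@tag_hook_lt c) => [[[|i] lti] j] /=.
    by move=> /(_ erefl) ltj _; rewrite (leq_trans ltj) // leq_addr.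
  by move=> _ lti'; rewrite ltn_add2l.
have hl k : h (lshift b k) = row_cell k.
  by rewrite /h -[lshift b k]/(unsplit (inl k)) unsplitK.
have hr k : h (rshift a.+1 k) = col_cell k.
  by rewrite /h -[rshift a.+1 k]/(unsplit (inr k)) unsplitK.
have gh : cancel h g.
  by move=> k; case: (split_ordP k) => j ->; apply: val_inj; rewrite gv ?hl ?hr.
have hg : cancel g h.
  move=> c; case: (split_ordP (g c)) => j ej; rewrite ej ?hl ?hr;
    have := congr1 val ej; rewrite gv => /=;
    case: c (@tagged_col0 c) (@tagged_row_lt c) {ej} => [[[|i] lti] k] /=.
  - by move=> _ _ e; apply: (@cell_eq (hook a b)).
  - by move=> _ _ e; have := ltn_ord j; rewrite -e -ltn_subRL subnn.
  - by move=> _ /(_ erefl) ltk e; move: ltk; rewrite e -ltn_subRL subnn.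
  by move=> k0 _ /addnI e; apply: (@cell_eq (hook a b)); rewrite /= ?e ?k0.
rewrite (reindex h); last by exists g => x _; [apply: gh | apply: hg].
rewrite big_split_ord /=.
by congr (_ * _); apply: eq_bigr => k _; rewrite ?hl ?hr.
Qed.

Definition tableau (p : words) : {ffun hcell -> 'I_n} :=
  [ffun c : hcell => if val (tag c) is i.+1 then nth (thead p.1) p.2 i
                     else nth (thead p.1) p.1 (tagged c)].

Lemma tableau_row p k : tableau p (row_cell k) = tnth p.1 k.
Proof. by rewrite ffunE /= (tnth_nth (thead p.1)). Qed.

Lemma tableau_col p k : tableau p (col_cell k) = tnth p.2 k.
Proof. by rewrite ffunE /= (tnth_nth (thead p.1)). Qed.

Lemma tableau_bij : bijective tableau.
Proof.
exists (fun T : {ffun hcell -> 'I_n} => ([tuple T (row_cell k) | k < a.+1],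
                  [tuple T (col_cell k) | k < b])).
  move=> [u v]; congr (_, _); apply: eq_from_tnth => k; rewrite tnth_mktuple.
    by rewrite tableau_row.
  by rewrite tableau_col.
move=> T; apply/ffunP => c.
have [c0|/eqP c0] := eqVneq (val (tag c)) 0%N.
  have -> : c = row_cell (Ordinal (tagged_row_lt c0)).
    by apply: (@cell_eq (hook a b)).
  by rewrite tableau_row tnth_mktuple.
have ltc : ((tag c).-1 < b)%N.
  by rewrite -ltnS prednK ?tag_hook_lt // lt0n; apply/eqP.
have -> : c = col_cell (Ordinal ltc).
  apply: (@cell_eq (hook a b)); rewrite /= ?prednK ?lt0n ?tagged_col0 //.
  exact/eqP.
by rewrite tableau_col tnth_mktuple.
Qed.

Lemma semistandard_tableau p : semistandard (tableau p) = hook_words p.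
Proof.
set i0 := thead p.1.
have rowE (c : hcell) : val (tag c) = 0%N ->
    tableau p c = nth i0 p.1 (tagged c).
  by move=> c0; rewrite ffunE c0.
have colE (c : hcell) : val (tagged c) = 0%N ->
    tableau p c = nth i0 (i0 :: p.2) (val (tag c)).
  move=> c0; rewrite ffunE; case: (val (tag c)) => //=.
  by rewrite c0; exact: (esym (tnth_nth i0 p.1 ord0)).
apply/idP/idP.
  move=> /forallP sT; apply/andP; split.
    apply/(sortedP 0%N) => k; rewrite size_map => ltk.
    rewrite !(nth_map i0) ?(ltnW ltk) //.
    have [lt1 lt2] : (k < a.+1)%N /\ (k.+1 < a.+1)%N.
      by move: ltk; rewrite size_tuple => ltk; rewrite ltk (ltnW ltk).
    have /forallP/(_ (row_cell (Ordinal lt2))) := sT (row_cell (Ordinal lt1)).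
    by rewrite !tableau_row !(tnth_nth i0) /= ltnSn => /andP[].
  apply/(sortedP 0%N) => k; rewrite size_map /= size_tuple => ltk.
  rewrite -map_cons !(nth_map i0) /= ?size_tuple // ?(ltnW ltk) //.
  have [c ec c0] := first_column_cell (ltnW ltk).
  have [d ed d0] := first_column_cell ltk.
  have /forallP/(_ d)/andP[_] := sT c.
  rewrite (colE c c0) (colE d d0) ec ed.
  move=> /implyP; apply; apply/andP; split.
    exact/eqP/(etrans c0 (esym d0)).
  exact: (eq_leq (etrans (congr1 S ec) (esym ed))).
case/andP=> wp sp; apply/forallP => c; apply/forallP => d; apply/andP; split.
  apply/implyP => /andP[/eqP ecd ltcd].
  have c0 : val (tag c) = 0%N.
    apply/eqP/negPn/negP => /eqP c0; move: ltcd.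
    by rewrite (@tagged_col0 d) ?ltn0 // -ecd.
  have d0 : val (tag d) = 0%N by rewrite -ecd.
  rewrite !rowE //; apply: weak_nth => //; first exact: ltnW.
  by rewrite size_tuple tagged_row_lt.
apply/implyP => /andP[/eqP ecd ltcd].
have d0 : val (tagged d) = 0%N.
  by apply: tagged_col0 => d0; rewrite d0 in ltcd.
have c0 : val (tagged c) = 0%N := etrans ecd d0.
rewrite (colE c c0) (colE d d0); apply: strict_nth => //=.
by rewrite size_tuple tag_hook_lt.
Qed.
End Shape.

(** * Symmetric functions and the Pieri rule for hooks *)

Section Sums.
Variables (R : comNzRingType) (x : 'rV[R]_n).

Definition weight (s : seq 'I_n) : R := \prod_(i <- s) x 0 i.

Definition complete_sym k : R := \sum_(u : k.-tuple 'I_n | weak u) weight u.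
Definition elementary_sym k : R :=
  \sum_(v : k.-tuple 'I_n | strict v) weight v.

Lemma schur_hookE a b : schur (hook a b) x =
  \sum_(p : a.+1.-tuple 'I_n * b.-tuple 'I_n | hook_words p)
     weight p.1 * weight p.2.
Proof.
rewrite /schur (reindex (@tableau a b)); last first.
  exact: onW_bij (@tableau_bij a b).
apply: eq_big => [p | p _]; first exact: semistandard_tableau.
rewrite prod_hook_cells /weight !big_tuple.
by congr (_ * _); apply: eq_bigr => k _; rewrite ?tableau_row ?tableau_col.
Qed.

Lemma schur_hook_row a : schur (hook a 0) x = complete_sym a.+1.
Proof.
rewrite schur_hookE (reindex (fun u : a.+1.-tuple 'I_n => (u, [tuple]))) /=.
  apply: eq_big => [u|u _]; first by rewrite /hook_words /= andbT.
  by rewrite {2}/weight /= big_nil mulr1.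
exists fst => [u _|[u v] _] //=; congr (_, _); exact/esym/tuple0.
Qed.

Lemma schur_hook_col b : schur (hook 0 b) x = elementary_sym b.+1.
Proof.
rewrite schur_hookE /elementary_sym
  (reindex (fun v : b.+1.-tuple 'I_n => ([tuple thead v], behead_tuple v))) /=.
  apply: eq_big => [v|v _].
    by case/tupleP: v => i v; rewrite /hook_words /= !theadE.
  case/tupleP: v => i v; rewrite !theadE /weight /= big_cons big_nil mulr1.
  by rewrite big_cons.
exists (fun p => cons_tuple (thead p.1) p.2) => [v _|[u v] _].
  by case/tupleP: v => i v; apply: val_inj; rewrite /= !theadE.
case/tupleP: u => i u; rewrite !theadE; congr (_, _); apply: val_inj => //=.
by rewrite (tuple0 u).
Qed.

(** A strictly increasing word over an alphabet of [n] letters has length at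
    most [n], and the first column of this hook has length [b.+1]. *)
Lemma schur_hook_tall a b : (n <= b)%N -> schur (hook a b) x = 0.
Proof.
move=> le_nb; rewrite schur_hookE big1 // => -[u v] /andP[_ sv].
have : uniq (thead u :: v).
  rewrite -(map_inj_uniq val_inj); apply: sorted_uniq sv.
    exact: ltn_trans.
  exact: ltnn.
move=> /card_uniqP e; have := max_card (mem (thead u :: v)).
by rewrite e card_ord /= size_tuple => /(leq_ltn_trans le_nb); rewrite ltnn.
Qed.

(** The two summands correspond to the two ways of comparing the first letters
    of a weak and a strict word: the smaller of them, taken from the column
    word in case of a tie, becomes the corner of the hook. *)
Lemma hook_pieri a b :
  complete_sym a.+1 * elementary_sym b.+1 =
  schur (hook a b.+1) x + schur (hook a.+1 b) x.
Proof.
rewrite !schur_hookE /complete_sym /elementary_sym big_distrlr /=.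
rewrite pair_big /=.
rewrite (bigID (fun p : a.+1.-tuple 'I_n * b.+1.-tuple 'I_n =>
                  (thead p.1 < thead p.2)%N)) /=.
congr (_ + _).
  apply: eq_bigl => -[u v]; rewrite /hook_words /=.
  case/tupleP: v => i v; rewrite !theadE /= /strict /= -andbA.
  by rewrite [path _ _ _ && _]andbC.
(* The first letter of the longer row goes back to the column word. *)
rewrite (reindex (fun p : a.+2.-tuple 'I_n * b.-tuple 'I_n =>
  (behead_tuple p.1, cons_tuple (thead p.1) p.2))) /=.
  apply: eq_big => -[u v]; case/tupleP: u => i u;
    rewrite /hook_words /= !theadE.
    case/tupleP: u => j u; rewrite /weak /=.
    have -> : thead (behead_tuple [tuple of [:: i, j & u]]) = j.
      by rewrite /thead (tnth_nth i).
    by rewrite -leqNgt andbAC [(_ <= _)%N && _]andbC.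
  by move=> _; rewrite /weight !big_cons mulrCA mulrA.
exists (fun p => (cons_tuple (thead p.2) p.1, behead_tuple p.2)) => -[u v] _ /=.
  by case/tupleP: u => i u; rewrite !theadE; congr (_, _); apply: val_inj.
by case/tupleP: v => i v; rewrite !theadE; congr (_, _); apply: val_inj.
Qed.

Lemma schur_hook_scale a b c :
  schur (hook a b) (c *: x) = c ^+ (a.+1 + b) * schur (hook a b) x.
Proof.
rewrite /schur mulr_sumr; apply: eq_bigr => T _.
rewrite (eq_bigr (fun k => c * x 0 (T k))) => [|k _]; last by rewrite mxE.
rewrite big_split /= prod_hook_cells !prodr_const !card_ord.
by rewrite -exprD.
Qed.
End Sums.
End HookTableaux.

(** * Solutions of the difference equation *)

Section Solutions.
Variables (R : realType) (n : nat).
Implicit Types (z : 'rV[R[i]]_n) (u x : nat -> R[i]).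

Lemma size_root_poly z : size (root_poly z) = n.+1.
Proof. by rewrite size_prod_XsubC /index_enum -enumT size_enum_ord. Qed.

Lemma coef_root_poly z (k : nat) : (k <= n)%N ->
  (root_poly z)`_(n - k) = (-1) ^+ k * elementary_sym z k.
Proof.
move=> le_kn; pose cs := [tuple z 0 j | j < n].
have -> : root_poly z = \prod_(c <- cs) ('X - c%:P).
  by rewrite big_tuple; apply: eq_bigr => j _; rewrite tnth_mktuple.
have := mpoly.mroots_coeff cs (Ordinal (le_kn : (k < n.+1)%N)).
rewrite /= => ->.
rewrite mpoly.mesym_tupleE; congr (_ * _).
rewrite (big_morph _ (mpoly.mevalD (tnth cs)) (mpoly.meval0 (tnth cs))).
apply: eq_bigr => h _.
rewrite (big_morph _ (mpoly.mevalM (tnth cs)) (mpoly.meval1 (tnth cs))).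
by apply: eq_bigr => i _; rewrite mpoly.mevalXU tnth_mktuple.
Qed.

Lemma solutions_recP z x :
  solutions (root_poly z) x <->
  forall s, x (s + n)%N =
    \sum_(j < n) (-1) ^+ (n - j.+1) * elementary_sym z (n - j) * x (s + j)%N.
Proof.
have lead : (root_poly z)`_n = 1.
  have /monicP := monic_prod_XsubC (index_enum 'I_n) predT (fun j => z 0 j).
  by rewrite /lead_coef size_root_poly.
suff E s : \sum_(k < size (root_poly z)) (root_poly z)`_k * x (s + k)%N =
    x (s + n)%N - \sum_(j < n) (-1) ^+ (n - j.+1) * elementary_sym z (n - j)
                    * x (s + j)%N.
  split=> Hx s; first by apply/eqP; rewrite -subr_eq0 -E; apply/eqP/Hx.
  by rewrite E -Hx subrr.
rewrite size_root_poly big_ord_recr /= lead mul1r addrC; congr (_ + _).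
rewrite -sumrN; apply: eq_bigr => j _; rewrite -mulNr; congr (_ * _).
rewrite -{1}(subKn (ltnW (ltn_ord j))) coef_root_poly ?leq_subr //.
by rewrite -mulNr -[in RHS]mulN1r -exprS subnSK.
Qed.

Lemma solutions_shift z x :
  solutions (root_poly z) x -> solutions (root_poly z) (fun s => x s.+1).
Proof.
by move=> Hx s /=; under eq_bigr do rewrite -addSn; exact: Hx.
Qed.

(** The alternating signs of Vieta's formula turn the elimination of [x n] into
    the difference [h_(a+1) e_(b+1) - s_(a|b+1)], which is [s_(a+1|b)] by the
    Pieri rule. *)
Lemma solution_term z x a : (0 < n)%N -> solutions (root_poly z) x ->
  x (n + a)%N =
  \sum_(j < n) (-1) ^+ (n - j.+1) * schur (hook a (n - j.+1)) z * x j.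
Proof.
move=> n_gt0; elim: a x => [|a IH] x Hx.
  move/solutions_recP: (Hx) => /(_ 0%N); rewrite addn0 add0n => ->.
  by apply: eq_bigr => j _; rewrite schur_hook_col subnSK.
rewrite addnS (IH _ (solutions_shift Hx)).
have pieri b : schur (hook a.+1 b) z =
    complete_sym z a.+1 * elementary_sym z b.+1 - schur (hook a b.+1) z.
  by rewrite hook_pieri addrC addKr.
under [RHS]eq_bigr => j _ do rewrite pieri mulrBr mulrBl subnSK //.
rewrite sumrB.
have -> : \sum_(j < n) (-1) ^+ (n - j.+1) *
    (complete_sym z a.+1 * elementary_sym z (n - j)) * x j =
    schur (hook a 0) z * x n.
  move/solutions_recP: (Hx) => /(_ 0%N); rewrite add0n => ->.
  rewrite schur_hook_row mulr_sumr; apply: eq_bigr => j _.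
  by rewrite add0n mulrCA !mulrA.
have tall := @schur_hook_tall n _ z a.
(* The subtracted sum has no [x 0] term: the hook there has a column of length
   [n.+1]. *)
move: (z) tall; clear -n_gt0; case: n n_gt0 => // m _ z tall.
rewrite [in LHS]big_ord_recr [X in _ - X]big_ord_recl /=.
rewrite subnn subn0 (tall m.+1) // mulr0 mul0r add0r expr0 mul1r addrC.
congr (_ + _).
rewrite -sumrN; apply: eq_bigr => j _; rewrite /bump /= add1n !subSS -!mulNr.
by rewrite -subnSK // exprS mulN1r.
Qed.

(** The companion recursion on the window [x s, .., x (s + n - 1)], which is
    encoded as a function on [nat] to keep the indices free of ordinal casts. *)
Definition companion_step z (u : nat -> R[i]) (k : nat) : R[i] :=
  if k.+1 == n then
    \sum_(j < n) (-1) ^+ (n - j.+1) * elementary_sym z (n - j) * u j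
  else u k.+1.

Definition solution_from z (u : nat -> R[i]) (s : nat) : R[i] :=
  iter s (companion_step z) u 0%N.

Lemma iter_companion_step z u s k : (k < n)%N ->
  iter s (companion_step z) u k = solution_from z u (s + k)%N.
Proof.
elim: k s => [|k IH] s ltk; first by rewrite addn0.
rewrite -addSnnS -IH; last exact: ltnW.
by rewrite iterS [RHS]/companion_step ltn_eqF.
Qed.

Lemma solution_from_solves z u : (0 < n)%N ->
  solutions (root_poly z) (solution_from z u).
Proof.
move=> n_gt0; apply/solutions_recP => s.
rewrite -{1}(prednK n_gt0) -addSnnS -iter_companion_step ?prednK //.
rewrite iterS [LHS]/companion_step prednK // eqxx.
by apply: eq_bigr => j _; rewrite iter_companion_step.
Qed.

Lemma solutions_unique z x y :
  solutions (root_poly z) x -> solutions (root_poly z) y ->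
  (forall k, (k < n)%N -> x k = y k) -> x = y.
Proof.
move=> /solutions_recP Hx /solutions_recP Hy e; apply/funext => s.
elim/ltn_ind: s => s IH; case: (ltnP s n) => [|les]; first exact: e.
rewrite -(subnK les) Hx Hy; apply: eq_bigr => j _; congr (_ * _).
by apply: IH; rewrite -ltn_subRL subKn // ltn_ord.
Qed.

Lemma solution_exists_unique z (v : 'rV[R[i]]_n) : (0 < n)%N -> exists x,
  solutions (root_poly z) `&` initial n @^-1` [set v] = [set x].
Proof.
move=> n_gt0; pose u k := if insub k is Some j then v 0 j else 0.
have su := solution_from_solves z u n_gt0.
have initu : initial n (solution_from z u) = v.
  apply/rowP => j; rewrite mxE -[X in solution_from _ _ X]add0n.
  by rewrite -iter_companion_step //= /u valK.
exists (solution_from z u); apply/seteqP; split=> [x [Hx xv]|x ->] //=.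
apply: solutions_unique Hx su _ => k ltk.
have := congr1 (fun w : 'rV[R[i]]_n => w 0 (Ordinal ltk))
  (etrans xv (esym initu)).
by rewrite !mxE.
Qed.

End Solutions.

(** * Moduli and phases *)

Section Moduli.
Variable R : realType.

Lemma normc_ge0 (z : R[i]) : 0 <= normc z.
Proof. by case: z => a b; exact: sqrtr_ge0. Qed.

Lemma normc_real (a : R) : normc a%:C = `|a|.
Proof. by rewrite /normc /= expr0n addr0 sqrtr_sqr. Qed.

Lemma normc_sum (I : finType) (P : pred I) (F : I -> R[i]) :
  normc (\sum_(i | P i) F i) <= \sum_(i | P i) normc (F i).
Proof.
elim/big_ind2: _ => [|a b c d ab cd|//]; first by rewrite normc0.
by apply: le_trans (le_normcD _ _) _; exact: lerD.
Qed.

Lemma normc_prod (I : finType) (F : I -> R[i]) :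
  normc (\prod_i F i) = \prod_i normc (F i).
Proof. exact: (big_morph _ (@normcM R) (@normc1 R)). Qed.

Lemma normcX (z : R[i]) k : normc (z ^+ k) = normc z ^+ k.
Proof. by elim: k => [|k IH]; rewrite ?normc1 // !exprS normcM IH. Qed.

Lemma normc_cis (a : R) : normc (cis a) = 1.
Proof. by rewrite /normc /cis cos2Dsin2 sqrtr1. Qed.

Lemma cisD (a b : R) : cis (a + b) = cis a * cis b.
Proof.
by apply/eqP; rewrite eq_complex /= cosD sinD [cos a * sin b + _]addrC !eqxx.
Qed.

Lemma cisMn (a : R) k : cis (a * k%:R) = cis a ^+ k.
Proof.
elim: k => [|k IH]; first by rewrite mulr0 /cis cos0 sin0.
by rewrite -natr1 mulrDr mulr1 cisD IH exprSr.
Qed.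

Lemma cispi : cis (pi : R) = -1.
Proof.
by rewrite /cis cospi sinpi; apply/eqP; rewrite eq_complex /= oppr0 !eqxx.
Qed.

Lemma schur_real n la (r : 'rV[R]_n) :
  schur la (map_mx (real_complex R) r) = (schur la r)%:C.
Proof.
rewrite /schur rmorph_sum; apply: eq_bigr => T _.
by rewrite rmorph_prod; apply: eq_bigr => c _; rewrite mxE.
Qed.

Lemma schur_ge0 n la (r : 'rV[R]_n) :
  (forall j, 0 <= r 0 j) -> 0 <= schur la r.
Proof. by move=> r_ge0; apply: sumr_ge0 => T _; apply: prodr_ge0. Qed.

Lemma normc_schur_le n la (r : 'rV[R]_n) z :
  polydisc r z -> normc (schur la z) <= schur la r.
Proof.
move=> rz; apply: le_trans (normc_sum _ _) _; apply: ler_sum => T _.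
by rewrite normc_prod; apply: ler_prod => c _; rewrite normc_ge0 rz.
Qed.

(** The common value of both suprema in the theorem, for [t = n + a]. *)
Definition hook_sum n (a : nat) (r w : 'rV[R]_n) : R :=
  \sum_(j < n) w 0 j * schur (hook a (n - j.+1)) r.

(** The signs in [solution_term] have modulus 1, and a Schur polynomial is
    largest on a polydisc at the point of the radii. *)
Lemma solution_bound n (a : nat) (r w : 'rV[R]_n) z x : (0 < n)%N ->
  polydisc r z -> solutions (root_poly z) x -> polydisc w (initial n x) ->
  normc (x (n + a)%N) <= hook_sum a r w.
Proof.
move=> n_gt0 rz xz wx; rewrite (solution_term a n_gt0 xz).
apply: le_trans (normc_sum _ _) _; apply: ler_sum => j _.
rewrite !normcM normcX normcN normc1 expr1n mul1r mulrC.
apply: ler_pM; rewrite ?normc_ge0 ?normc_schur_le //.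
by have := wx j; rewrite mxE.
Qed.

(** With [m = n - j], the [j]-th Schur polynomial has degree [a + m], hence
    contributes the phase [(cis theta) ^+ (a + m)]; the sign and the initial
    value contribute [(-1) ^+ m] and [cis (pi - theta) ^+ m], whose product is
    [(cis theta) ^- m]. Only [(cis theta) ^+ a] is left. *)
Lemma aligned_solution_term n a (r w : 'rV[R]_n) (theta : R) x : (0 < n)%N ->
  solutions (root_poly (\row_(j < n) ((r 0 j)%:C * cis theta))) x ->
  initial n x =
    \row_(j < n) (- ((w 0 j)%:C * cis ((pi - theta) * (n - j)%:R))) ->
  x (n + a)%N = cis theta ^+ a * (hook_sum a r w)%:C.
Proof.
move=> n_gt0 xz xv; rewrite (solution_term a n_gt0 xz).
have -> : \row_(j < n) ((r 0 j)%:C * cis theta) =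
    cis theta *: map_mx (real_complex R) r.
  by apply/rowP => j; rewrite !mxE mulrC.
rewrite /hook_sum rmorph_sum mulr_sumr; apply: eq_bigr => j _.
have := congr1 (fun u : 'rV[R[i]]_n => u 0 j) xv; rewrite !mxE => ->.
rewrite schur_hook_scale schur_real rmorphM /= cisMn.
have phase : cis (pi - theta) * cis theta = -1.
  by rewrite -cisD subrK cispi.
have -> : (a.+1 + (n - j.+1) = a + (n - j))%N by rewrite addSnnS subnSK.
(* Writing the sign as a phase makes the cancellation a polynomial identity. *)
have -> : (-1) ^+ (n - j.+1) = - (cis (pi - theta) * cis theta) ^+ (n - j).
  by rewrite phase -(subnSK (ltn_ord j)) exprS mulN1r opprK.
have sq : (cis (pi - theta) * cis theta) ^+ (n - j) *
    (cis (pi - theta) * cis theta) ^+ (n - j) = 1.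
  by rewrite -exprMn phase mulrNN mulr1 expr1n.
rewrite -[RHS]mulr1 -sq !exprMn exprD; ring.
Qed.

End Moduli.

Theorem theorem1 (R : realType) (n t : nat) (n_gt0 : (0 < n)%N)
    (le_nt : (n <= t)%N) (r w : 'rV[R]_n)
    (r_ge0 : forall j : 'I_n, 0 <= r 0 j) (w_ge0 : forall j : 'I_n, 0 <= w 0 j)
    (theta : R) :
  let f := root_poly (\row_(j < n) ((r 0 j)%:C * cis theta)) in
  let U := polydisc w in
  let v : 'rV[R[i]]_n :=
    \row_(j < n) (- ((w 0 j)%:C * cis ((pi - theta) * (n - j)%:R))) in
  [/\ MM t (polydisc r) U = M t f U,
      M t f U =
        (\sum_(j < n) w 0 j * schur (hook (t - n) (n - j.+1)) r)%:E
    & exists x : nat -> R[i],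
        [/\ solutions f `&` initial n @^-1` [set v] = [set x],
            U v
          & (normc (x t))%:E = M t f U]].
Proof.
move=> f U v.
pose a := (t - n)%N; have ta : t = (n + a)%N by rewrite subnKC.
have rf : polydisc r (\row_(j < n) ((r 0 j)%:C * cis theta)).
  by move=> j; rewrite mxE normcM normc_real normc_cis mulr1 ger0_norm.
have Uv : U v.
  by move=> j; rewrite mxE normcN normcM normc_real normc_cis mulr1 ger0_norm.
have upper z : polydisc r z -> (M t (root_poly z) U <= (hook_sum a r w)%:E)%E.
  move=> rz; apply: ge_ereal_sup => _ [x [xz Ux] <-].
  by rewrite lee_fin ta; exact: solution_bound xz Ux.
have [x x_only] := solution_exists_unique
  (\row_(j < n) ((r 0 j)%:C * cis theta)) v n_gt0.
have [xf xv] : (solutions f `&` initial n @^-1` [set v]) x by rewrite x_only.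
have xt : normc (x t) = hook_sum a r w.
  rewrite ta (aligned_solution_term a n_gt0 xf xv).
  rewrite normcM normcX normc_cis expr1n mul1r normc_real ger0_norm //.
  by apply: sumr_ge0 => j _; rewrite mulr_ge0 ?schur_ge0.
have lower : ((hook_sum a r w)%:E <= M t f U)%E.
  rewrite -xt; apply: ereal_sup_ubound; exists x => //; split => //.
  by rewrite /= xv.
have Mf : M t f U = (hook_sum a r w)%:E.
  by apply/eqP; rewrite eq_le upper.
split=> //; last by exists x; split; rewrite ?xt.
apply/eqP; rewrite Mf eq_le; apply/andP; split.
  by apply: ge_ereal_sup => _ [z rz <-]; exact: upper.
rewrite -Mf; apply: ereal_sup_ubound.
by exists (\row_(j < n) ((r 0 j)%:C * cis theta)).
Qed.
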